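(* Let $n\ge 0$ be an integer. There is a surjective map $$p_n\colon \{\mathrm{SL}_2\text{-friezes of width } n\}\longrightarrow \{\text{Y-friezes of width } n\}$$ determined by $$p_n(A)_{i,j}=A_{i,j+1}\,A_{i+1,j}.$$ At most two $\mathrm{SL}_2$-friezes lie in the same fibre of $p_n$. Specifically, two $\mathrm{SL}_2$-friezes of width $n$ with distinct quiddities $(\sigma_i)_{i\in\mathbb{Z}}$ and $(\sigma_i')_{i\in\mathbb{Z}}$ map to the same Y-frieze under $p_n$ if and only if $n$ is odd and there is $\lambda\in\{\tfrac13,\tfrac12,2,3\}$ such that $\sigma'_o=\lambda\sigma_o$ for all odd indices $o$ and $\sigma_e=\lambda\sigma'_e$ for all even indices $e$.
   Context: Let $n\ge 0$ and $a\in\mathbb{Z}$. A staggered array of width $n$ bounded by $a$'s is a map $m\colon\{(i,j)\in\mathbb{Z}\times\mathbb{Z}: 1\le i-j\le n+2\}\to\mathbb{Z}$ with $m_{i+1,i}=m_{i+n+2,i}=a$ for all $i\in\mathbb{Z}$, and $m_{i,j}>0$ for $2\le i-j\le n+1$. An $\mathrm{SL}_2$-frieze of width $n$ is a staggered array $A$ of width $n$ bounded by $1$'s such that $A_{i,j}A_{i+1,j+1}-A_{i,j+1}A_{i+1,j}=1$ for $2\le i-j\le n+1$. Its quiddity is the sequence $\sigma_i=A_{i+1,i-1}$, $i\in\mathbb{Z}$ (the row below the top row). A Y-frieze of width $n$ is a staggered array $B$ of width $n$ bounded by $0$'s such that $(B_{i,j+1}+1)(B_{i+1,j}+1)=B_{i,j}B_{i+1,j+1}$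 for $2\le i-j\le n+1$. The formula for $p_n(A)_{i,j}$ is applied for $2\le i-j\le n+1$; the boundary entries of $p_n(A)$ (those with $i-j=1$ or $i-j=n+2$) are $0$ (equivalently, one uses the convention $A_{i,i}=A_{i+n+3,i}=0$). *)

(* Defs.v *)
From mathcomp Require Import all_boot all_order all_algebra.

Set Implicit Arguments.
Unset Strict Implicit.
Unset Printing Implicit Defensive.

Import Order.TTheory GRing.Theory Num.Theory.
Local Open Scope ring_scope.

Definition strip (n : nat) : Type :=
  {ij : int * int | 1 <= ij.1 - ij.2 <= n.+2%:Z}.

(* Extension by 0 outside the strip, so that entries can be written without
   membership proofs. The rules below are only imposed where every entry they
   mention lies in the strip. *)
Definition entry (n : nat) (m : strip n -> int) (i j : int) : int :=
  oapp m 0 (insub (i, j) : option {ij : int * int | 1 <= ij.1 - ij.2 <= n.+2%:Z}).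

Record staggered_array (n : nat) (a : int) : Type := StaggeredArray {
  array_map : strip n -> int;
  array_top : forall i : int, entry array_map (i + 1) i = a;
  array_bottom : forall i : int, entry array_map (i + n%:Z + 2) i = a;
  array_gt0 : forall i j : int,
    2 <= i - j <= n.+1%:Z -> 0 < entry array_map i j }.

Definition array_entry (n : nat) (a : int) (m : staggered_array n a) :
  int -> int -> int := entry (array_map m).

Coercion array_entry : staggered_array >-> Funclass.

Record SL2_frieze (n : nat) : Type := SL2Frieze {
  SL2_array :> staggered_array n 1;
  SL2_rule : forall i j : int, 2 <= i - j <= n.+1%:Z ->
    SL2_array i j * SL2_array (i + 1) (j + 1)
      - SL2_array i (j + 1) * SL2_array (i + 1) j = 1 }.

Record Y_frieze (n : nat) : Type := YFrieze {
  Y_array :> staggered_array n 0;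
  Y_rule : forall i j : int, 2 <= i - j <= n.+1%:Z ->
    (Y_array i (j + 1) + 1) * (Y_array (i + 1) j + 1)
      = Y_array i j * Y_array (i + 1) (j + 1) }.

Definition quiddity (n : nat) (A : SL2_frieze n) (i : int) : int :=
  A (i + 1) (i - 1).

(* The boundary entries of [p A] are 0 because [p A] is a Y-frieze. *)
Definition frieze_map_formula (n : nat) (p : SL2_frieze n -> Y_frieze n) : Prop :=
  forall (A : SL2_frieze n) (i j : int), 2 <= i - j <= n.+1%:Z ->
    p A i j = A i (j + 1) * A (i + 1) j.

(* Main.v *)
(**
Let K(i, d) be the continuant of s_i, ..., s_(i+d-1). An SL2-frieze with
quiddity s has entries A_(i,j) = K(j+1, i-j-1), and a positive rational
sequence s with s_i s_(i+1) = B_(i+1,i-1) + 1 satisfies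
B_(i+d+1,i-1) = K(i, d+2) K(i+1, d) for every Y-frieze B.

Surjectivity: the integrality of B forces s_i s_j to be an integer whenever
i - j is odd. If n is even, replacing s_i by s_i K(i+1, n+1) makes s integral;
if n is odd, s has even period n+3, and multiplying its even terms and dividing
its odd terms by a suitable constant does so. The continuants K(i, n+1) are
then positive integers with K(i, n+1) K(i+1, n+1) = 1, hence equal to 1.

Fibres: p_n(A) determines the products s_i s_(i+1), hence s up to a factor
lambda on odd and 1/lambda on even indices; lambda = 1 for n even because
K(i, n+1) = 1. If lambda = a/b in lowest terms, then b divides the odd terms and
a the even terms of s, so the continuants would grow if ab >= 4.
*)

Require Import Defs.
From mathcomp Require Import all_boot all_order all_algebra.
From mathcomp Require Import boolp zify ring lra.

Set Implicit Arguments.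
Unset Strict Implicit.
Unset Printing Implicit Defensive.

Import Order.TTheory GRing.Theory Num.Theory.
Local Open Scope ring_scope.

(** * Continuants and their rescaling *)

(** The determinant of the tridiagonal matrix with [s i], ..., [s (i + d - 1)] on the diagonal and
    ones next to it. *)
Fixpoint continuant (R : comNzRingType) (s : int -> R) (i : int) (d : nat) : R :=
  match d with
  | 0 => 1
  | d1.+1 =>
      match d1 with
      | 0 => s i
      | d2.+1 => s (i + d1%:Z) * continuant s i d1 - continuant s i d2
      end
  end.

Section Continuant.
Variables (R : comNzRingType) (s : int -> R).
Local Notation K := (continuant s).

Lemma continuantSr i d :
  K i d.+2 = s (i + d.+1%:Z) * K i d.+1 - K i d.
Proof. by []. Qed.

(** Expansion of the determinant along its first row instead of its last. The recurrence reaches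
    back two steps, so two consecutive lengths are proved together. *)
Lemma continuantSl i d : K i d.+2 = s i * K (i + 1) d.+1 - K (i + 1 + 1) d.
Proof.
suff [] : K i d.+2 = s i * K (i + 1) d.+1 - K (i + 1 + 1) d
  /\ K i d.+3 = s i * K (i + 1) d.+2 - K (i + 1 + 1) d.+1 by [].
elim: d => [|d [IH1 IH2]].
  split; first by rewrite /= mulrC.
  rewrite !continuantSr /=.
  have -> : i + 2 = i + 1 + 1 by lia.
  ring.
split=> //; rewrite continuantSr IH1 IH2 (continuantSr (i + 1) d.+1).
rewrite (continuantSr (i + 1 + 1) d).
have -> : i + d.+3%:Z = i + 1 + d.+2%:Z by lia.
have -> : i + 1 + 1 + d.+1%:Z = i + 1 + d.+2%:Z by lia.
ring.
Qed.

(** Expanding [K i d.+3] and [K (i + 1) d.+2], which share their last term, turns the case [d.+1]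
    into the case [d]. *)
Lemma continuant_plucker i d :
  K i d.+1 * K (i + 1) d.+1 - K i d.+2 * K (i + 1) d = 1.
Proof.
elim: d => [|d IH]; first by rewrite /=; ring.
rewrite -[RHS]IH (continuantSr i d.+1) (continuantSr (i + 1) d).
have -> : i + 1 + d.+1%:Z = i + d.+2%:Z by lia.
ring.
Qed.

End Continuant.

(** Such a sequence alternates between [w i] and its inverse; the factor [w i] for odd [m] expresses
    this without inverses, so that it makes sense in any ring. *)
Lemma alternating_inverses (R : comNzRingType) (w : int -> R) i m :
  (forall j, w j * w (j + 1) = 1) ->
  w (i + m%:Z) * (if odd m then w i else 1) = (if odd m then 1 else w i).
Proof.
move=> ww.
elim: m => [|m IH] /=; first by rewrite addr0 mulr1.
have := ww (i + m%:Z); have -> : i + m%:Z + 1 = i + m.+1%:Z by lia.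
move: IH; case: (odd m) => /=; last by rewrite !mulr1 => -> <-; rewrite mulrC.
move=> E1 E2; rewrite mulr1 -[RHS]mul1r -E2 mulrAC E1 mul1r //.
Qed.

(** Every monomial of a continuant arises from the product of all its terms by deleting disjoint
    adjacent pairs. The weights of a deleted pair multiply to 1, so all monomials carry the same
    weight. *)
Lemma continuant_rescale (R : comNzRingType) (s w : int -> R) i d :
    (forall j, w j * w (j + 1) = 1) ->
  continuant (fun j => w j * s j) i d =
    (if odd d then w i else 1) * continuant s i d.
Proof.
move=> ww.
suff [] : continuant (fun j => w j * s j) i d
           = (if odd d then w i else 1) * continuant s i d
  /\ continuant (fun j => w j * s j) i d.+1
           = (if odd d.+1 then w i else 1) * continuant s i d.+1 by [].
elim: d => [|d [IH1 IH2]]; first by rewrite /= mul1r.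
split=> //; rewrite !continuantSr IH1 IH2.
have := alternating_inverses i d.+1 ww; rewrite [odd d.+2]/= [odd d.+1]/=.
by case: (odd d) => /= <-; ring.
Qed.

Lemma rmorph_continuant (R S : comNzRingType) (f : {rmorphism R -> S})
    (s : int -> R) i d :
  f (continuant s i d) = continuant (f \o s) i d.
Proof.
suff [] : f (continuant s i d) = continuant (f \o s) i d
  /\ f (continuant s i d.+1) = continuant (f \o s) i d.+1 by [].
elim: d => [|d [IH1 IH2]]; first by rewrite /= rmorph1.
by split=> //; rewrite !continuantSr rmorphB rmorphM IH1 IH2.
Qed.

Lemma eq_continuant (R : comNzRingType) (s t : int -> R) i d :
  s =1 t -> continuant s i d = continuant t i d.
Proof. by move=> /funext ->. Qed.

(** * Integrality of products at odd distance *)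

Section Integrality.
Variable s : int -> rat.
Local Notation K := (continuant s).

Definition odd_products_int (l : nat) := forall (a : int) (k : nat),
  (k < l)%N -> s a * s (a + k.*2.+1%:Z) \is a Num.int.

(** The indices in a monomial of a continuant alternate in parity. In even length the factors
    therefore group into pairs at odd distance; in odd length a factor of even offset is left over,
    and [y] absorbs it. *)
Lemma continuant_int l : odd_products_int l -> forall i,
  K i l.*2 \is a Num.int /\
  forall y, (forall k, (k <= l)%N -> y * s (i + k.*2%:Z) \is a Num.int) ->
    y * K i l.*2.+1 \is a Num.int.
Proof.
elim: l => [_ i|l IH sl i].
  by split=> [|y /(_ 0 (leqnn 0))]; rewrite /= ?addr0.
have [|IHe IHo] := IH _ i; first by move=> a k kl; apply: sl; lia.
have IHe' : K i l.*2.+2 \is a Num.int.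
  rewrite continuantSr rpredB //; apply: IHo => k kl.
  rewrite mulrC; have := sl (i + k.*2%:Z) (l - k)%N; rewrite ltnS leq_subr.
  have -> : i + k.*2%:Z + (l - k).*2.+1%:Z = i + l.*2.+1%:Z by lia.
  exact.
rewrite doubleS; split=> // y ys; rewrite continuantSr mulrBr rpredB //.
  by rewrite mulrA rpredM //; have := ys l.+1; rewrite doubleS; apply.
by apply: IHo => k kl; apply: ys; lia.
Qed.

(** The sign is the monomial in which all terms are deleted. The induction step applies
    [continuant_int] with [z] times the newest term as [y]. *)
Lemma continuant_even_mod l z i : odd_products_int l ->
  (forall j k, (j < l)%N -> (k < l)%N ->
     z * (s (i + j.*2%:Z) * s (i + k.*2.+1%:Z)) \is a Num.int) ->
  z * (K i l.*2 - (-1) ^+ l) \is a Num.int.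
Proof.
elim: l => [_ _|l IH sl zl]; first by rewrite /= subrr mulr0.
have sl' : odd_products_int l by move=> a k kl; apply: sl; lia.
have {IH} IH : z * (K i l.*2 - (-1) ^+ l) \is a Num.int.
  by apply: IH => // j k jl kl; apply: zl; lia.
rewrite doubleS continuantSr exprS.
have -> : z * (s (i + l.*2.+1%:Z) * K i l.*2.+1 - K i l.*2 - -1 * (-1) ^+ l)
  = (z * s (i + l.*2.+1%:Z)) * K i l.*2.+1 - z * (K i l.*2 - (-1) ^+ l) by ring.
apply: rpredB => //; apply: (continuant_int sl' i).2 => k kl.
by rewrite -mulrA [s _ * s _]mulrC; apply: zl.
Qed.

(* Modulo integers, [K a (2k+2) * K (a+1) (2k)] is [z * K (a+1) (2k) ^ 2] with
   [z = s a * s (a+2k+1)], hence [z] itself, since [K (a+1) (2k)] is [(-1)^k]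
   plus products of pairs whose multiples by [z] are integers by induction. *)
Lemma odd_products_intP n :
  (forall i d, (d <= n)%N -> K i d.+2 * K (i + 1) d \is a Num.int) ->
  forall l, (l.*2 <= n.+2)%N -> odd_products_int l.
Proof.
move=> KK; elim=> [//|l IH ln a k].
have {IH} sl : odd_products_int l by apply: IH; lia.
have ln' : (l.*2 <= n)%N by move: ln; rewrite doubleS.
rewrite ltnS leq_eqVlt => /orP[/eqP ->|]; last exact: sl.
have := KK a l.*2 ln'; move: sl ln' {ln}.
case: l => [_ _|l sl _].
  rewrite /= mulr1 => z1; rewrite -[X in X \is a _](subrK 1) rpredD //.
  by rewrite mulrC.
set z := s a * _; set Q := K (a + 1) _ => zQ.
have Q_int : Q \is a Num.int := (continuant_int sl _).1.
have sl' : odd_products_int l by move=> b j jl; apply: sl; lia.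
have zQQ : z * Q * Q \is a Num.int.
  have -> : z * Q * Q = K a l.+1.*2.+2 * Q
     + s (a + l.+1.*2.+1%:Z) * K (a + 1 + 1) l.*2.+1 * Q + K a l.+1.*2 * Q.
    rewrite [K a l.+1.*2.+2]continuantSr doubleS [K a l.*2.+3]continuantSl.
    by rewrite /Q /z doubleS; ring.
  apply: rpredD; last by rewrite rpredM // (continuant_int sl _).1.
  apply: rpredD => //; apply: rpredM => //.
  apply: (continuant_int sl' _).2 => k' kl.
  rewrite mulrC; have := sl (a + 1 + 1 + k'.*2%:Z) (l - k')%N.
  have -> : a + 1 + 1 + k'.*2%:Z + (l - k')%N.*2.+1%:Z = a + l.+1.*2.+1%:Z by lia.
  by apply; lia.
have zQ1 : z * (Q - (-1) ^+ l.+1) \is a Num.int.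
  apply: continuant_even_mod => // j k' jl kl; rewrite /z mulrACA rpredM //.
    have -> : a + 1 + j.*2%:Z = a + j.*2.+1%:Z by lia.
    exact: sl.
  rewrite mulrC; have := sl (a + 1 + k'.*2.+1%:Z) (l - k')%N.
  have -> : a + 1 + k'.*2.+1%:Z + (l - k')%N.*2.+1%:Z = a + l.+1.*2.+1%:Z by lia.
  by apply; lia.
have -> : z = z * Q * Q - z * (Q - (-1) ^+ l.+1) * (Q + (-1) ^+ l.+1).
  have := sqrr_sign rat l.+1; rewrite expr2 => E.
  rewrite -[LHS]mulr1 -[X in z * X = _]E; ring.
by rewrite rpredB // rpredM // rpredD // rpredX // rpredN1.
Qed.

End Integrality.

(** * Rational lifts of a Y-frieze and their continuants *)

Lemma alternating_lift (t : int -> rat) : (forall i, 0 < t i) ->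
  exists s : int -> rat, forall i, 0 < s i /\ s i * s (i + 1) = t i.
Proof.
move=> t0.
(* Starting from the value 1 at index 0, the terms are forced in both directions: [fwd k] is the
   term at [k] and [bwd k] the one at [-k]. *)
pose fwd := fix fwd k := if k is k'.+1 then t k'%:Z / fwd k' else 1.
pose bwd := fix bwd k := if k is k'.+1 then t (- k%:Z) / bwd k' else 1.
have fwd0 k : 0 < fwd k by elim: k => //= k IH; rewrite divr_gt0.
have bwd0 k : 0 < bwd k by elim: k => [|k IH] //=; rewrite divr_gt0.
exists (fun i => match i with Posz k => fwd k | Negz k => bwd k.+1 end).
case=> [k|[|k]]; split=> //.
- by rewrite addrC /= mulrC divfK // gt_eqF.
- by rewrite NegzE addrC subrr /= mulr1 divr1.
have -> : Negz k.+1 + 1 = Negz k by lia.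
by rewrite /= NegzE divfK // gt_eqF // -[_ / _]/(bwd k.+1).
Qed.

Section YTable.
Variables (n : nat) (b : int -> nat -> int).

(* [b i d] is the entry of a Y-frieze at position [(i + d + 1, i - 1)]. *)
Hypothesis b_bottom : forall i, b i n = 0.
Hypothesis b_gt0 : forall i d, (d < n)%N -> 0 < b i d.
(** The row of zeros above [b i 0] has no index in the table, so the Y-rule next to it is a separate
    case with a single factor on the left. *)
Hypothesis b_rule0 : forall i, (0 < n)%N -> b i 1 + 1 = b i 0 * b (i + 1) 0.
Hypothesis b_ruleS : forall i d, (d.+1 < n)%N ->
  (b (i + 1) d + 1) * (b i d.+2 + 1) = b i d.+1 * b (i + 1) d.+1.

Definition lifts (R : numDomainType) (s : int -> R) :=
  forall i, 0 < s i /\ s i * s (i + 1) = (b i 0 + 1)%:~R.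

Section Lift.
Variables (R : numFieldType) (s : int -> R).
Hypothesis s_lifts : lifts s.
Local Notation K := (continuant s).

(** The Y-rule computes a row from the two above it, and by [continuant_plucker] the products of
    continuants obey the same rule. Positivity is proved alongside, because passing to the next row
    cancels continuants of earlier rows. *)
Lemma lift_continuants d i : (d <= n)%N ->
  [/\ (b i d)%:~R = K i d.+2 * K (i + 1) d, 0 < K i d & 0 < K i d.+1].
Proof.
pose P e := forall i,
  [/\ (b i e)%:~R = K i e.+2 * K (i + 1) e, 0 < K i e & 0 < K i e.+1].
have P0 : P 0%N.
  move=> j; split; rewrite ?ltr01 //; last exact: (s_lifts j).1.
  have /eqP := (s_lifts j).2; rewrite intrD -subr_eq => /eqP <-.
  by rewrite /= mulr1 mulrC.
have bS e : P e -> forall j, (b j e + 1)%:~R = K j e.+1 * K (j + 1) e.+1.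
  move=> Pe j; rewrite intrD; have [-> _ _] := Pe j.
  by rewrite -(continuant_plucker s j e) addrC subrK.
have K_gt0 e j : (e < n)%N -> P e -> 0 < K j e.+2.
  move=> en Pe; have [E _ _] := Pe j; have [_ K0 _] := Pe (j + 1).
  by rewrite -(pmulr_lgt0 _ K0) -E ltr0z b_gt0.
have P1 : (0 < n)%N -> P 1%N.
  move=> n0 j; split; [|exact: (s_lifts j).1|exact: K_gt0].
  apply: (addIr 1); rewrite -[1 in LHS]/(1%:~R) -intrD b_rule0 //.
  have [E _ _] := P0 j; have [E1 _ _] := P0 (j + 1).
  have K0 k : K k 0 = 1 by [].
  rewrite intrM E E1 !K0 !mulr1; have /eqP := continuant_plucker s j 1.
  by rewrite subr_eq => /eqP ->; rewrite [RHS]addrC.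
have PSS e : (e.+1 < n)%N -> P e -> P e.+1 -> P e.+2.
  move=> en Pe PSe j; have [E1 K0 K1] := PSe j; split=> //; last exact: K_gt0.
  have [E2 L0 L1] := PSe (j + 1); have [_ M0 M1] := PSe (j + 1 + 1).
  have := congr1 (fun z : int => z%:~R : R) (b_ruleS j en).
  rewrite !intrM bS // E1 E2 intrD.
  rewrite [X in _ = X](_ : _ =
    K (j + 1) e.+1 * K (j + 1 + 1) e.+1 * (K j e.+3 * K (j + 1) e.+3)); last ring.
  move/mulfI; rewrite mulf_neq0 ?gt_eqF // => /(_ isT) /eqP.
  rewrite eq_sym -subr_eq => /eqP <-.
  have := continuant_plucker s j e.+2.
  by move=> E; rewrite -E subKr.
move=> dn; suff [] : P d /\ ((d < n)%N -> P d.+1) by move=> /(_ i).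
elim: d dn => [|d IH] dn; first by split.
have [Pd PSd] := IH (ltnW dn).
by split=> [|dn']; [exact: PSd|apply: PSS => //; exact: PSd].
Qed.

Lemma lift_continuant_gt0 d i : (d <= n.+1)%N -> 0 < K i d.
Proof.
case: d => [_|d dn]; first exact: ltr01.
by have [] := lift_continuants i dn.
Qed.

Lemma lift_continuantE d i : (d <= n)%N ->
  (b i d)%:~R = K i d.+2 * K (i + 1) d.
Proof. by case/(lift_continuants i). Qed.

Lemma lift_continuant_zero i : K i n.+2 = 0.
Proof.
have /eqP := lift_continuantE i (leqnn n); rewrite b_bottom eq_sym mulf_eq0.
by rewrite [K (i + 1) n == 0]gt_eqF ?orbF ?lift_continuant_gt0 // => /eqP.
Qed.

Lemma lift_continuant_consecutive i : K i n.+1 * K (i + 1) n.+1 = 1.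
Proof.
have := continuant_plucker s i n.
by rewrite lift_continuant_zero mul0r subr0.
Qed.

End Lift.

Lemma lift_odd_products_int (s : int -> rat) l : lifts s ->
  (l.*2 <= n.+2)%N -> odd_products_int s l.
Proof.
move=> ls; apply: odd_products_intP => i d dn.
by rewrite -(lift_continuantE ls) // intr_int.
Qed.

Lemma int_continuant_bottom (s : int -> rat) i : lifts s ->
  (forall j, continuant s j n.+1 \is a Num.int) -> continuant s i n.+1 = 1.
Proof.
move=> ls sint.
have ge1 j : 1 <= continuant s j n.+1.
  have := lift_continuant_gt0 ls j (leqnn _).
  by have /intrP[m ->] := sint j; rewrite ltr0z ler1z.
apply: le_anti; rewrite ge1 andbT -(lift_continuant_consecutive ls i).
by rewrite ler_peMr // (le_trans ler01).
Qed.

Lemma rat_lift : exists s : int -> rat, lifts s.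
Proof.
apply: alternating_lift => i; rewrite ltr0z.
(* For [n = 0] the row [b i 0] is already the bottom row of zeros. *)
have [n0|n0] := posnP n; last by rewrite addr_gt0 ?b_gt0.
by have := b_bottom i; rewrite n0 => ->.
Qed.

(** * Integral lifts *)

Lemma even_int_lift : ~~ odd n ->
  exists s : int -> rat, lifts s /\ forall i, s i \is a Num.int.
Proof.
move=> n_even; have [s ls] := rat_lift.
have nE : n = n./2.*2 by rewrite -[LHS]odd_double_half (negPf n_even).
(* Neighbouring factors are inverse by [lift_continuant_consecutive], so this is still a lift. As
   [n.+1] is odd, integrality is [continuant_int] with [s i] as [y]. *)
exists (fun i => s i * continuant s (i + 1) n.+1); split=> i.
  split; first by rewrite mulr_gt0 ?(lift_continuant_gt0 ls) //; case: (ls i).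
  rewrite mulrACA (ls i).2 (lift_continuant_consecutive ls) mulr1 //.
have sl : odd_products_int s n./2.+1.
  by apply: (lift_odd_products_int ls); rewrite doubleS -nE.
rewrite nE; apply: (continuant_int _ _).2 => [a k kn|k kn].
  by apply: sl; rewrite ltnW.
have -> : i + 1 + k.*2%:Z = i + k.*2.+1%:Z by lia.
exact: sl.
Qed.

(** All continuants of length [n.+1] are 1. Expanding the vanishing continuant of length [n.+2] at
    [i] on the left and the one at [i + 2] on the right expresses both terms as the continuant of
    length [n] at [i + 2]. *)
Lemma odd_lift_periodic (s : int -> rat) i : odd n -> lifts s ->
  s (i + n.+3%:Z) = s i.
Proof.
move=> n_odd ls.
have nE : n.+1 = n./2.+1.*2.
  by rewrite doubleS -[in LHS](odd_double_half n) n_odd add1n.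
have K1 j : continuant s j n.+1 = 1.
  apply: int_continuant_bottom => // k; rewrite nE.
  by apply: (continuant_int _ k).1; apply: (lift_odd_products_int ls); rewrite -nE.
have := lift_continuant_zero ls (i + 1 + 1); have := lift_continuant_zero ls i.
rewrite continuantSl (continuantSr _ (i + 1 + 1)) !K1 !mulr1.
move=> /subr0_eq -> /subr0_eq <-; congr s; lia.
Qed.

(** Distances up to [n] are covered by [lift_odd_products_int]. By periodicity, distance [n.+2] is a
    product of neighbours, and larger distances drop by the even period [n.+3]. *)
Lemma odd_lift_products (s : int -> rat) e o : odd n -> lifts s ->
  (2 %| e)%Z -> ~~ (2 %| o)%Z -> s e * s o \is a Num.int.
Proof.
move=> n_odd ls.
have nE : n = n./2.*2.+1 by rewrite -[in LHS](odd_double_half n) n_odd add1n.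
have sl k a : s a * s (a + k.*2.+1%:Z) \is a Num.int.
  elim/ltn_ind: k a => k IH a; have [kn|nk] := leqP k n./2.
    have := lift_odd_products_int (l := n./2.+1) ls; apply=> //.
    by rewrite doubleS {2}nE.
  have [kn|nk'] := leqP k n./2.+1.
    rewrite -(odd_lift_periodic a) //.
    have -> : a + n.+3%:Z = a + k.*2.+1%:Z + 1 by rewrite nE; lia.
    by rewrite mulrC (ls _).2 intr_int.
  have := IH (k - n./2.+2)%N _ a; rewrite -(odd_lift_periodic (a + _)) //.
  have -> : a + (k - n./2.+2).*2.+1%:Z + n.+3%:Z = a + k.*2.+1%:Z by rewrite nE; lia.
  by apply; lia.
move=> e2 o2; have [eo|oe] := leP e o.
  have -> : o = e + (`|o - e|./2).*2.+1%:Z by lia.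
  exact: sl.
have -> : e = o + (`|e - o|./2).*2.+1%:Z by lia.
by rewrite mulrC.
Qed.

(* The rescaling factor is [g / s 0], where [g] is the gcd of the integers
   [s 0 * s o] over all odd [o], here as their largest common divisor. *)
Lemma odd_int_lift : odd n ->
  exists s : int -> rat, lifts s /\ forall i, s i \is a Num.int.
Proof.
move=> n_odd; have [s ls] := rat_lift.
have s0 i : s i != 0 by have [/gt_eqF ->] := ls i.
have u_int o : ~~ (2 %| o)%Z -> s 0 * s o \is a Num.int.
  exact: odd_lift_products.
pose u o := Num.floor (s 0 * s o).
have uE o : ~~ (2 %| o)%Z -> (u o)%:~R = s 0 * s o.
  by move=> /u_int; rewrite intrEfloor => /eqP.
pose P (d : nat) := `[< forall o, ~~ (2 %| o)%Z -> (d %| u o)%Z >].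
have P1 : exists d, P d by exists 1%N; apply/asboolP => o _; exact: dvd1z.
have Pub d : P d -> (d <= `|u 1|)%N.
  move/asboolP => /(_ 1 isT) du; apply: dvdn_leq => //.
  by rewrite absz_gt0 -(intr_eq0 rat) uE // mulf_neq0.
have [g /asboolP gu gmax] := ex_maxnP P1 Pub.
have g0 : (0 < g)%N by apply: (gmax 1%N); apply/asboolP => o _; exact: dvd1z.
have gq e : (2 %| e)%Z -> g%:R * (s e / s 0) \is a Num.int.
  move=> e2; set q := s e / s 0.
  (* Since [q * u o = s e * s o] is an integer, the denominator of [q] divides every [u o] with [o]
     odd. Its lcm with [g] is then a common divisor too, and maximality makes it equal to [g]. *)
  have dq : (`|denq q| %| g)%N.
    have l0 : (0 < lcmn `|denq q| g)%N by rewrite lcmn_gt0 g0 absz_gt0 denq_eq0.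
    have /gmax lg : P (lcmn `|denq q| g).
      apply/asboolP => o o2; rewrite dvdz_lcm gu // andbT dvdzE absz_nat -dvdzE.
      suff : (denq q %| numq q * u o)%Z.
        by rewrite Gauss_dvdzr // coprimezE coprime_sym coprime_num_den.
      have /intrP[m mE] := odd_lift_products n_odd ls e2 o2.
      apply/dvdzP; exists m; apply/eqP; rewrite -(eqr_int rat) !intrM uE // -mE.
      rewrite numqE; apply/eqP; move: (denq q) => d; rewrite /q; field.
      exact: s0.
    by rewrite -(_ : lcmn `|denq q| g = g) ?dvdn_lcml //; apply/eqP;
      rewrite eqn_leq lg dvdn_leq ?dvdn_lcmr.
  have /dvdzP[k kE] : (denq q %| g%:Z)%Z by rewrite dvdzE.
  have -> : g%:R = k%:~R * (denq q)%:~R :> rat by rewrite -intrM -kE.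
  by rewrite -mulrA [_%:~R * q]mulrC -numqE -intrM intr_int.
pose c := g%:R / s 0.
have c0 : 0 < c by rewrite divr_gt0 ?ltr0n //; case: (ls 0).
exists (fun i => if (2 %| i)%Z then c * s i else s i / c); split=> i.
  have [si sii] := ls i; split.
    by case: ifP => _; [apply: mulr_gt0 | apply: divr_gt0].
  have -> : (2 %| i + 1)%Z = ~~ (2 %| i)%Z by lia.
  by case: (2 %| i)%Z => /=; rewrite -sii; field; rewrite ?gt_eqF // s0.
case: ifPn => i2.
  by have := gq _ i2; rewrite /c mulrAC mulrA.
have /dvdzP[m mE] := gu _ i2.
have -> : s i / c = m%:~R.
  have g0' : g%:R != 0 :> rat by rewrite pnatr_eq0 -lt0n.
  have := uE _ i2; rewrite mE intrM /c -[(Posz g)%:~R]/(g%:R) => E.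
  apply: (mulIf g0'); rewrite E; field; exact/andP.
exact: intr_int.
Qed.

Lemma int_lift : exists s : int -> int,
  [/\ forall i d, (d <= n.+1)%N -> 0 < continuant s i d,
      forall i, continuant s i n.+1 = 1
    & forall i d, (d <= n)%N ->
        b i d = continuant s i d.+2 * continuant s (i + 1) d].
Proof.
have [s [ls sint]] : exists s : int -> rat, lifts s /\ forall i, s i \is a Num.int.
  by case: (boolP (odd n)) => [/odd_int_lift|/even_int_lift].
have KE i d : (continuant (fun i => Num.floor (s i)) i d)%:~R = continuant s i d.
  rewrite rmorph_continuant; apply: eq_continuant => j /=.
  by apply/eqP; rewrite -intrEfloor.
exists (fun i => Num.floor (s i)); split=> [i d dn|i|i d dn].
- by rewrite -(ltr0z rat) KE lift_continuant_gt0.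
- apply: (@intr_inj rat); rewrite KE int_continuant_bottom // => j.
  by rewrite -KE intr_int.
- by apply: (@intr_inj rat); rewrite intrM !KE (lift_continuantE ls).
Qed.

End YTable.

(** * Growth of continuants *)

Lemma continuant_growth (s : int -> int) (x y i : int) l :
  0 < x -> 0 < y -> 4 <= x * y ->
  (forall k, x <= s (i + k.*2%:Z)) -> (forall k, y <= s (i + k.*2.+1%:Z)) ->
  1 < continuant s i l.+1.*2.
Proof.
move=> x0 y0 xy sx sy.
set K := continuant s i.
(* The model is the constant sequence 2 with [x = y = 2]: there the continuant of length [d] is
   [d + 1] and the last inequality is an equality. *)
suff [] : [/\ 1 <= K l.*2, 0 < K l.*2.+1
            & 2 * K l.*2 + 2 <= y * K l.*2.+1].
  move=> K0 K1 yK; rewrite doubleS [K _]continuantSr -/(K l.*2.+1) -/(K l.*2).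
  have := ler_wpM2r (ltW K1) (sy l); nia.
elim: l => [|l [K0 K1 yK]].
  have /= := sx 0%N; rewrite addr0 /K /= => H; split; rewrite ?(lt_le_trans x0) //.
  nia.
have E2 : K l.*2.+2 = s (i + l.*2.+1%:Z) * K l.*2.+1 - K l.*2 by [].
have E3 : K l.*2.+3 = s (i + l.+1.*2%:Z) * K l.*2.+2 - K l.*2.+1 by [].
have H2 : y * K l.*2.+1 + 2 <= 2 * K l.*2.+2.
  have := ler_wpM2r (ltW K1) (sy l); rewrite E2; lia.
have K2 : 1 <= K l.*2.+2 by lia.
have H3 : y * (x * K l.*2.+2) <= y * (K l.*2.+3 + K l.*2.+1).
  rewrite ler_pM2l // E3 subrK; apply: ler_wpM2r => //; lia.
have H4 : 4 * K l.*2.+2 <= y * (x * K l.*2.+2).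
  by rewrite mulrA [y * x]mulrC ler_wpM2r //; lia.
have yK3 : 2 * K l.*2.+2 + 2 <= y * K l.*2.+3.
  lra.
rewrite doubleS; split=> //.
by rewrite -(pmulr_rgt0 _ y0); lra.
Qed.

(** * Arrays on the strip *)

Section StripFunctions.
Variable n : nat.

Definition in_strip (i j : int) : bool := 1 <= i - j <= n.+2%:Z.

Definition restrict_strip (f : int -> int -> int) : strip n -> int :=
  fun ij => f (val ij).1 (val ij).2.

Lemma entry_restrict f i j :
  entry (restrict_strip f) i j = if in_strip i j then f i j else 0.
Proof.
rewrite /entry /in_strip; case: insubP => [u /= -> uE|/= /negPf -> //].
by rewrite /= /restrict_strip [val u]uE.
Qed.

Lemma entry_out (m : strip n -> int) i j : ~~ in_strip i j -> entry m i j = 0.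
Proof. by move=> ij; rewrite /entry insubN. Qed.

Lemma entry_inj (m m' : strip n -> int) :
  (forall i j, in_strip i j -> entry m i j = entry m' i j) -> m = m'.
Proof.
move=> mm'; apply/funext => u; have := mm' _ _ (valP u).
by rewrite /entry -surjective_pairing valK.
Qed.

(** The boundary rows are prescribed, and the proof fields agree by proof irrelevance. *)
Lemma staggered_array_inj a (m m' : staggered_array n a) :
  (forall i j : int, 2 <= i - j <= n.+1%:Z -> m i j = m' i j) -> m = m'.
Proof.
move=> mm'; have : array_map m = array_map m'.
  apply: entry_inj => i j; rewrite /in_strip => ij.
  have [ij1|ij1] := eqVneq (i - j) 1.
    by have -> : i = j + 1 by [lia]; rewrite !array_top.
  have [ij2|ij2] := eqVneq (i - j) n.+2%:Z.
    by have -> : i = j + n%:Z + 2 by [lia]; rewrite !array_bottom.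
  by apply: mm'; lia.
case: m m' {mm'} => [f f1 f2 f3] [g g1 g2 g3] /= fg; subst g.
by congr StaggeredArray; apply: Prop_irrelevance.
Qed.

Lemma SL2_frieze_inj (A A' : SL2_frieze n) :
  (forall i j : int, 2 <= i - j <= n.+1%:Z -> A i j = A' i j) -> A = A'.
Proof.
move/staggered_array_inj; case: A A' => [A rA] [A' rA'] /= E; subst A'.
by congr SL2Frieze; apply: Prop_irrelevance.
Qed.

Lemma Y_frieze_inj (B B' : Y_frieze n) :
  (forall i j : int, 2 <= i - j <= n.+1%:Z -> B i j = B' i j) -> B = B'.
Proof.
move/staggered_array_inj; case: B B' => [B rB] [B' rB'] /= E; subst B'.
by congr YFrieze; apply: Prop_irrelevance.
Qed.

Lemma staggered_top a (m : staggered_array n a) i j : i - j = 1 -> m i j = a.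
Proof. by move=> ij; have -> : i = j + 1 by [lia]; exact: array_top. Qed.

Lemma staggered_bottom a (m : staggered_array n a) i j :
  i - j = n.+2%:Z -> m i j = a.
Proof. by move=> ij; have -> : i = j + n%:Z + 2 by [lia]; exact: array_bottom. Qed.

Lemma staggered_gt0 (m : staggered_array n 1) i j : in_strip i j -> 0 < m i j.
Proof.
rewrite /in_strip => ij; have [ij1|ij1] := eqVneq (i - j) 1.
  by rewrite staggered_top.
have [ij2|ij2] := eqVneq (i - j) n.+2%:Z; first by rewrite staggered_bottom.
by apply: array_gt0; lia.
Qed.

(* Unlike [SL2_rule], this uses the value 0 of [entry] outside the strip. *)
Lemma SL2_rule_strip (A : SL2_frieze n) i j : in_strip i j ->
  A i j * A (i + 1) (j + 1) - A i (j + 1) * A (i + 1) j = 1.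
Proof.
rewrite /in_strip => ij; have [ij1|ij1] := eqVneq (i - j) 1.
  have -> : A i (j + 1) = 0 by apply: entry_out; rewrite /in_strip; lia.
  rewrite mul0r subr0 (staggered_top A ij1) mul1r staggered_top //; lia.
have [ij2|ij2] := eqVneq (i - j) n.+2%:Z.
  have -> : A (i + 1) j = 0 by apply: entry_out; rewrite /in_strip; lia.
  rewrite mulr0 subr0 (staggered_bottom A ij2) mul1r staggered_bottom //; lia.
by apply: SL2_rule; lia.
Qed.

End StripFunctions.

(** * SL2-friezes as tables of continuants *)

Section Friezes.
Variable n : nat.

Lemma in_stripP i j : in_strip n i j ->
  exists2 d : nat, (d <= n.+1)%N & i = j + d.+1%:Z.
Proof. by rewrite /in_strip => ij; exists `|i - j|.-1%N; lia. Qed.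

Lemma continuant_SL2_frieze (s : int -> int) :
  (forall i d, (d <= n.+1)%N -> 0 < continuant s i d) ->
  (forall i, continuant s i n.+1 = 1) ->
  exists A : SL2_frieze n, forall j d, (d <= n.+1)%N ->
    A (j + d.+1%:Z) j = continuant s (j + 1) d.
Proof.
move=> K_gt0 K1.
pose m := restrict_strip (n := n) (fun i j => continuant s (j + 1) `|i - j|.-1%N).
have mE j d : (d <= n.+1)%N -> entry m (j + d.+1%:Z) j = continuant s (j + 1) d.
  move=> dn; rewrite entry_restrict ifT; last by rewrite /in_strip; lia.
  by congr continuant; lia.
have m_top i : entry m (i + 1) i = 1 by rewrite (mE i 0%N).
have m_bottom i : entry m (i + n%:Z + 2) i = 1.
  have -> : i + n%:Z + 2 = i + n.+2%:Z by lia.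
  by rewrite mE.
have m_gt0 i j : 2 <= i - j <= n.+1%:Z -> 0 < entry m i j.
  move=> ij; have /in_stripP[d dn ->] : in_strip n i j by rewrite /in_strip; lia.
  by rewrite mE // K_gt0.
pose A := StaggeredArray m_top m_bottom m_gt0.
have A_rule i j : 2 <= i - j <= n.+1%:Z ->
    A i j * A (i + 1) (j + 1) - A i (j + 1) * A (i + 1) j = 1.
  move=> ij; have [d dn ->] : exists2 d : nat, (d < n)%N & i = j + d.+2%:Z.
    by exists (`|i - j| - 2)%N; lia.
  rewrite /A /array_entry /=.
  have -> : j + d.+2%:Z + 1 = j + d.+3%:Z by lia.
  rewrite !mE; try lia.
  have -> : j + d.+3%:Z = j + 1 + d.+2%:Z by lia.
  have -> : j + d.+2%:Z = j + 1 + d.+1%:Z by lia.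
  rewrite !mE; try lia.
  by rewrite [X in _ - X]mulrC continuant_plucker.
by exists (SL2Frieze A_rule).
Qed.

(** The SL2-rule and [continuant_plucker] are the same relation. It can be solved for the entry of
    the next row because the entry multiplying it is positive. *)
Lemma SL2_frieze_continuant (A : SL2_frieze n) j d : (d <= n.+1)%N ->
  A (j + d.+1%:Z) j = continuant (quiddity A) (j + 1) d.
Proof.
pose P e := (e <= n.+1)%N -> forall k,
  A (k + e.+1%:Z) k = continuant (quiddity A) (k + 1) e.
suff [] : P d /\ P d.+1 by move=> Pd _ dn; exact: Pd.
elim: d => [|d [IH1 IH2]].
  split=> _ k; first by rewrite staggered_top //; lia.
  by rewrite /= /quiddity addrK; congr (A _ _); lia.
split=> // dn k.
have k_strip : in_strip n (k + d.+2%:Z) k by rewrite /in_strip; lia.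
have k1_strip : in_strip n (k + d.+2%:Z) (k + 1) by rewrite /in_strip; lia.
have := staggered_gt0 A k1_strip.
have := etrans (SL2_rule_strip A k_strip)
  (esym (continuant_plucker (quiddity A) (k + 1) d)).
have -> : k + d.+2%:Z + 1 = k + 1 + d.+2%:Z by lia.
rewrite !IH2 1?ltnW //.
have -> : A (k + d.+2%:Z) (k + 1) = continuant (quiddity A) (k + 1 + 1) d.
  by rewrite -IH1; [congr (A _ _); lia | lia].
have -> : k + 1 + d.+2%:Z = k + d.+3%:Z by lia.
move=> /addrI/oppr_inj + K_gt0; rewrite mulrC => /mulIf; apply.
by rewrite gt_eqF.
Qed.

(** * The map to Y-friezes and its surjectivity *)

Definition Y_of_SL2_map (A : SL2_frieze n) : strip n -> int :=
  restrict_strip (fun i j => A i (j + 1) * A (i + 1) j).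

(** No strip condition is imposed: outside the strip one of the two factors lies outside as well and
    is 0. The same default value yields the zero boundary rows. *)
Lemma Y_of_SL2_mapE A i j :
  entry (Y_of_SL2_map A) i j = A i (j + 1) * A (i + 1) j.
Proof.
rewrite entry_restrict; case: ifPn => // ij.
have [ij1|ij1] := leP (i - j) 0.
  by rewrite [A i _]entry_out ?mul0r // /in_strip; lia.
by rewrite [A (i + 1) _]entry_out ?mulr0 //; move: ij; rewrite /in_strip; lia.
Qed.

Lemma Y_of_SL2_top A i : entry (Y_of_SL2_map A) (i + 1) i = 0.
Proof.
by rewrite Y_of_SL2_mapE [A (i + 1) (i + 1)]entry_out ?mul0r // /in_strip; lia.
Qed.

Lemma Y_of_SL2_bottom A i : entry (Y_of_SL2_map A) (i + n%:Z + 2) i = 0.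
Proof.
by rewrite Y_of_SL2_mapE [A (_ + 1) _]entry_out ?mulr0 // /in_strip; lia.
Qed.

Lemma Y_of_SL2_gt0 A i j : 2 <= i - j <= n.+1%:Z -> 0 < entry (Y_of_SL2_map A) i j.
Proof.
move=> ij; rewrite Y_of_SL2_mapE.
by rewrite mulr_gt0 // staggered_gt0 // /in_strip; lia.
Qed.

Definition Y_of_SL2_array A : staggered_array n 0 :=
  StaggeredArray (Y_of_SL2_top A) (Y_of_SL2_bottom A) (@Y_of_SL2_gt0 A).

(** The SL2-rule at [(i, j + 1)] and [(i + 1, j)], possibly boundary positions, turns each factor on
    the left into a product of two entries; the four entries regroup into the right side. *)
Lemma Y_of_SL2_rule A i j : 2 <= i - j <= n.+1%:Z ->
  (Y_of_SL2_array A i (j + 1) + 1) * (Y_of_SL2_array A (i + 1) j + 1)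
  = Y_of_SL2_array A i j * Y_of_SL2_array A (i + 1) (j + 1).
Proof.
move=> ij; rewrite /array_entry !Y_of_SL2_mapE.
have /eqP := @SL2_rule_strip n A i (j + 1) ltac:(rewrite /in_strip; lia).
have /eqP := @SL2_rule_strip n A (i + 1) j ltac:(rewrite /in_strip; lia).
rewrite !subr_eq ![1 + _]addrC => /eqP E1 /eqP E2.
by rewrite -[X in X * _]E2 -[X in _ * X]E1; ring.
Qed.

Definition Y_of_SL2 A : Y_frieze n := YFrieze (@Y_of_SL2_rule A).

Lemma Y_of_SL2E A i j : Y_of_SL2 A i j = A i (j + 1) * A (i + 1) j.
Proof. exact: Y_of_SL2_mapE. Qed.

Lemma Y_of_SL2_surjective (B : Y_frieze n) : exists A, Y_of_SL2 A = B.
Proof.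
pose b i (d : nat) := B (i + d.+1%:Z) (i - 1).
have [||||s [K_gt0 K1 bE]] := @int_lift n b.
- by move=> i; rewrite /b staggered_bottom //; lia.
- by move=> i d dn; apply: array_gt0; lia.
- move=> i n0; have := @Y_rule n B (i + 1) (i - 1) ltac:(lia).
  rewrite (staggered_top B) ?add0r ?mul1r; last lia.
  rewrite /b; have -> : i + 1 + 1 = i + 2 by lia.
  by have -> : i - 1 + 1 = i + 1 - 1 by [lia].
- move=> i d dn; have := @Y_rule n B (i + d.+2%:Z) (i - 1) ltac:(lia).
  rewrite /b; have -> : i + 1 + d.+1%:Z = i + d.+2%:Z by lia.
  have -> : i + 1 + d.+2%:Z = i + d.+2%:Z + 1 by lia.
  have -> : i + d.+3%:Z = i + d.+2%:Z + 1 by lia.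
  by have -> : i - 1 + 1 = i + 1 - 1 by [lia].
have [A AE] := continuant_SL2_frieze K_gt0 K1; exists A.
apply: Y_frieze_inj => i j ij; rewrite Y_of_SL2E.
have [d dn ->] : exists2 d : nat, (d < n)%N & i = j + d.+2%:Z.
  by exists (`|i - j| - 2)%N; lia.
have -> : j + d.+2%:Z + 1 = j + d.+3%:Z by lia.
rewrite AE; last lia.
have := bE (j + 1) d (ltnW dn); rewrite /b addrK.
have -> : j + d.+2%:Z = j + 1 + d.+1%:Z by lia.
by move=> ->; rewrite mulrC AE //; lia.
Qed.


(** * Fibres of the map *)

Definition scaled_quiddity (lambda : rat) (A A' : SL2_frieze n) :=
  (forall o : int, ~~ (2 %| o)%Z ->
     (quiddity A' o)%:~R = lambda * (quiddity A o)%:~R) /\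
  (forall e : int, (2 %| e)%Z ->
     (quiddity A e)%:~R = lambda * (quiddity A' e)%:~R).

Lemma quiddity_inj (A A' : SL2_frieze n) : quiddity A = quiddity A' -> A = A'.
Proof.
move=> AA'; apply: SL2_frieze_inj => i j ij.
have [d dn ->] : exists2 d : nat, (d <= n.+1)%N & i = j + d.+1%:Z.
  by apply: in_stripP; rewrite /in_strip; lia.
by rewrite !SL2_frieze_continuant // AA'.
Qed.

Lemma continuant_quiddity_bottom (A : SL2_frieze n) i :
  continuant (quiddity A) i n.+1 = 1.
Proof.
rewrite -[i](subrK 1) -SL2_frieze_continuant // staggered_bottom //; lia.
Qed.

Lemma quiddity_gt0 (A : SL2_frieze n) i : 0 < quiddity A i.
Proof. by apply: staggered_gt0; rewrite /in_strip; lia. Qed.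

Lemma quiddity_consecutive (A : SL2_frieze n) i :
  quiddity A i * quiddity A (i + 1) = Y_of_SL2 A (i + 1) (i - 1) + 1.
Proof.
have := @SL2_rule_strip n A (i + 1) (i - 1) ltac:(rewrite /in_strip; lia).
rewrite Y_of_SL2E /quiddity !addrK => /eqP; rewrite subr_eq => /eqP ->.
by rewrite [RHS]addrC.
Qed.

Lemma scaled_quiddityP lambda (A A' : SL2_frieze n) :
  lambda != 0 -> scaled_quiddity lambda A A' ->
  forall i d, ((continuant (quiddity A') i d)%:~R : rat) =
    (if odd d then if (2 %| i)%Z then lambda^-1 else lambda else 1)
      * (continuant (quiddity A) i d)%:~R.
Proof.
move=> l0 [sco sce] i d.
pose w (j : int) := if (2 %| j)%Z then lambda^-1 else lambda.
have ww j : w j * w (j + 1) = 1.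
  rewrite /w; have -> : (2 %| j + 1)%Z = ~~ (2 %| j)%Z by lia.
  by case: (2 %| j)%Z; rewrite /= ?mulVf ?mulfV.
rewrite !rmorph_continuant -(continuant_rescale _ _ _ ww).
apply: eq_continuant => j /=; rewrite /w; case: ifPn => j2; last exact: sco.
by rewrite sce // mulKf.
Qed.

(** Each entry is a product of two continuants whose lengths have equal parity and whose starting
    indices have opposite parity, so their scaling factors cancel. *)
Lemma Y_of_SL2_scaled lambda (A A' : SL2_frieze n) :
  lambda != 0 -> scaled_quiddity lambda A A' -> Y_of_SL2 A = Y_of_SL2 A'.
Proof.
move=> l0 sc; apply: Y_frieze_inj => i j ij; rewrite !Y_of_SL2E.
have [d dn ->] : exists2 d : nat, (d < n)%N & i = j + d.+2%:Z.
  by exists (`|i - j| - 2)%N; lia.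
have -> : j + d.+2%:Z + 1 = j + d.+3%:Z by lia.
have long (C : SL2_frieze n) :
    C (j + d.+3%:Z) j = continuant (quiddity C) (j + 1) d.+2.
  by rewrite SL2_frieze_continuant.
have short (C : SL2_frieze n) :
    C (j + d.+2%:Z) (j + 1) = continuant (quiddity C) (j + 1 + 1) d.
  by rewrite -SL2_frieze_continuant; [congr (C _ _); lia | lia].
rewrite !long !short; apply: (@intr_inj rat).
rewrite !intrM !(scaled_quiddityP l0 sc) /= negbK.
have -> : (2 %| j + 1 + 1)%Z = ~~ (2 %| j + 1)%Z by lia.
by case: (odd d); case: (2 %| j + 1)%Z => /=; field.
Qed.

Lemma fibre_scaled (A A' : SL2_frieze n) : Y_of_SL2 A = Y_of_SL2 A' ->
  exists2 lambda, 0 < lambda & scaled_quiddity lambda A A'.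
Proof.
move=> YA; pose w i : rat := (quiddity A' i)%:~R / (quiddity A i)%:~R.
have q_gt0 (C : SL2_frieze n) i : 0 < (quiddity C i)%:~R :> rat.
  by rewrite ltr0z quiddity_gt0.
have q0 (C : SL2_frieze n) i : (quiddity C i)%:~R != 0 :> rat by rewrite gt_eqF.
have ww i : w i * w (i + 1) = 1.
  rewrite /w mulrACA -invfM -!intrM !quiddity_consecutive YA mulfV //.
  by rewrite -quiddity_consecutive intrM mulf_neq0.
have w_even i k : w (i + k.*2%:Z) = w i.
  have := alternating_inverses i k.*2 ww.
  by rewrite odd_double mulr1.
have wo o : ~~ (2 %| o)%Z -> w o = w 1.
  move=> o2; have [o1|o1] := leP 1 o.
    by rewrite -(w_even 1 `|o - 1|./2); congr w; lia.
  by rewrite -(w_even o `|1 - o|./2); congr w; lia.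
exists (w 1); first by rewrite divr_gt0.
split=> [o o2|e e2]; first by rewrite -(wo o) // /w divfK.
have := ww e; rewrite (wo (e + 1)); last lia.
by move=> we; rewrite -[LHS]mul1r -we {1}/w; field; rewrite q0.
Qed.

(** Otherwise [continuant_growth], started at the odd index 1 with even length [n.+1], contradicts
    the value 1 of that continuant. *)
Lemma quiddity_small (A : SL2_frieze n) (x y : int) : odd n -> 0 < x -> 0 < y ->
  (forall o, ~~ (2 %| o)%Z -> x <= quiddity A o) ->
  (forall e, (2 %| e)%Z -> y <= quiddity A e) -> x * y < 4.
Proof.
move=> n_odd x0 y0 qx qy; rewrite ltNge; apply/negP => xy.
have nE : n.+1 = n./2.+1.*2.
  by rewrite doubleS -[in LHS](odd_double_half n) n_odd add1n.
have := @continuant_growth (quiddity A) x y 1 n./2 x0 y0 xy.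
rewrite -nE continuant_quiddity_bottom => H; suff : (1 : int) < 1 by [].
by apply: H => k; [apply: qx | apply: qy]; lia.
Qed.

Definition scalings : seq rat := [:: 1 / 3; 1 / 2; 2; 3].

Lemma fibre_scalings (A A' : SL2_frieze n) lambda : 0 < lambda ->
  scaled_quiddity lambda A A' -> lambda != 1 -> odd n /\ lambda \in scalings.
Proof.
move=> l0 sc l1.
have n_odd : odd n.
  apply: contraR l1 => n_even.
  (* In the odd length [n.+1], starting at 1, the continuants differ by the factor [lambda], yet
     both equal 1. *)
  have := scaled_quiddityP (lt0r_neq0 l0) sc 1 n.+1.
  by rewrite !continuant_quiddity_bottom /= n_even mulr1 => <-.
split=> //.
have sc_int o : ~~ (2 %| o)%Z ->
    quiddity A' o * denq lambda = numq lambda * quiddity A o.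
  move=> o2; apply: (@intr_inj rat); rewrite !intrM sc.1 // numqE; ring.
have sc_int' e : (2 %| e)%Z ->
    quiddity A e * denq lambda = numq lambda * quiddity A' e.
  move=> e2; apply: (@intr_inj rat); rewrite !intrM sc.2 // numqE; ring.
have cop : coprimez (numq lambda) (denq lambda) := coprime_num_den lambda.
have le_dvd (d : int) i : 0 < d -> (d %| quiddity A i)%Z -> d <= quiddity A i.
  move=> d0 /dvdzP[m mE]; have := quiddity_gt0 A i; rewrite mE pmulr_lgt0 // => m0.
  by rewrite ler_peMl // ?ltW.
have num0 : 0 < numq lambda by rewrite numq_gt0.
have := @quiddity_small A (denq lambda) (numq lambda) n_odd (denq_gt0 _) num0.
have /[swap]/[apply] : forall o, ~~ (2 %| o)%Z -> denq lambda <= quiddity A o.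
  move=> o o2; apply: le_dvd; rewrite ?denq_gt0 //.
  rewrite -(@Gauss_dvdzr _ (numq lambda)) 1?coprimez_sym //.
  by rewrite -sc_int // dvdz_mull.
have /[swap]/[apply] : forall e, (2 %| e)%Z -> numq lambda <= quiddity A e.
  move=> e e2; apply: le_dvd => //.
  by rewrite -(@Gauss_dvdzl _ _ (denq lambda)) // sc_int' // dvdz_mulr.
have := denq_gt0 lambda; move: num0 l1.
rewrite -[lambda in lambda != 1]divq_num_den
  -[lambda in lambda \in _]divq_num_den.
move: (numq lambda) (denq lambda) => a b a0 ab b0 ab4.
(* These are the positive pairs with product below 4 other than (2,2) and beyond; the pair (1,1) is
   ruled out by [lambda != 1]. *)
have : [|| (a == 1) && (b == 1), (a == 1) && (b == 2), (a == 1) && (b == 3),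
          (a == 2) && (b == 1) | (a == 3) && (b == 1)] by nia.
move: ab => /[swap]; rewrite /scalings.
by case/or4P=> [||| /orP[]] /andP[/eqP-> /eqP->]; rewrite !inE.
Qed.

Lemma fibre_cases (A A' : SL2_frieze n) : Y_of_SL2 A = Y_of_SL2 A' ->
  exists2 lambda, scaled_quiddity lambda A A'
    & A = A' \/ odd n /\ lambda \in scalings.
Proof.
move=> /fibre_scaled[l l0 sc]; exists l => //.
have [l1|/(fibre_scalings l0 sc)] := eqVneq l 1; last by right.
left; apply: quiddity_inj; apply/funext => i; apply: (@intr_inj rat).
case: (boolP (2 %| i)%Z) => i2; first by rewrite sc.2 // l1 mul1r.
by rewrite sc.1 // l1 mul1r.
Qed.

(** For three distinct friezes the factors would satisfy [l13 = l23 * l12], but no product of two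
    members of [scalings] is again a member. *)
Lemma fibre_size (A1 A2 A3 : SL2_frieze n) :
  Y_of_SL2 A1 = Y_of_SL2 A2 -> Y_of_SL2 A1 = Y_of_SL2 A3 ->
  [\/ A1 = A2, A1 = A3 | A2 = A3].
Proof.
move=> Y12 Y13; have Y23 : Y_of_SL2 A2 = Y_of_SL2 A3 by rewrite -Y12.
have [l12 sc12 [|[_ l12s]]] := fibre_cases Y12; first by constructor 1.
have [l13 sc13 [|[_ l13s]]] := fibre_cases Y13; first by constructor 2.
have [l23 sc23 [|[_ l23s]]] := fibre_cases Y23; first by constructor 3.
have l123 : l13 = l23 * l12.
  have q0 : (quiddity A1 1)%:~R != 0 :> rat by rewrite intr_eq0 gt_eqF ?quiddity_gt0.
  by apply: (mulIf q0); rewrite -mulrA -sc12.1 // -sc23.1 // sc13.1.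
suff /allP/(_ _ l23s)/allP/(_ _ l12s) :
    all (fun l => all (fun m => l * m \notin scalings) scalings) scalings.
  by rewrite -l123 l13s.
by vm_compute.
Qed.

End Friezes.

Theorem theoremB (n : nat) :
  exists p : SL2_frieze n -> Y_frieze n,
    [/\ unique (@frieze_map_formula n) p,
        forall B : Y_frieze n, exists A : SL2_frieze n, p A = B,
        forall (B : Y_frieze n) (A1 A2 A3 : SL2_frieze n),
          p A1 = B -> p A2 = B -> p A3 = B ->
          [\/ A1 = A2, A1 = A3 | A2 = A3]
      & forall A A' : SL2_frieze n, quiddity A <> quiddity A' ->
          (p A = p A' <->
           odd n /\
           exists2 lambda : rat,
             lambda \in [:: 1 / 3; 1 / 2; 2; 3]
             & (forall o : int, ~~ (2 %| o)%Z ->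
                  (quiddity A' o)%:~R = lambda * (quiddity A o)%:~R) /\
               (forall e : int, (2 %| e)%Z ->
                  (quiddity A e)%:~R = lambda * (quiddity A' e)%:~R))].
Proof.
exists (@Y_of_SL2 n); split.
- split=> [A i j _|p pE]; first exact: Y_of_SL2E.
  apply/funext => A; apply: Y_frieze_inj => i j ij.
  by rewrite pE // Y_of_SL2E.
- exact: Y_of_SL2_surjective.
- by move=> B A1 A2 A3 <- /esym + /esym; exact: fibre_size.
- move=> A A' qA; split=> [/fibre_cases[l sc []]|[n_odd [l ls]]].
  + by move=> AA'; case: qA; rewrite AA'.
  + by case=> n_odd ls; split=> //; exists l.
  + by apply: Y_of_SL2_scaled; apply: contraTneq ls => ->.
Qed.
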